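(* Let $P$ be a finite poset, $\Bbbk$ a field, $n\ge1$, and let $R=\bigcup_{j=1}^n\{j\}\times R_j\subseteq[n]\times P$ with all $R_j$ nonempty. The multidegree $R$ occurs in the first ($n$-)linear strand of the resolution of $L(n,P)$, i.e. $\beta_{|R|-n,R}(L(n,P))\neq0$, if and only if for every $j=1,\ldots,n-1$ and every pair of elements $p\in R_j$ and $q\in R_{j+1}$ we have $p\le q$. In this case the Betti number $\beta_{|R|-n,R}(L(n,P))$ equals $1$.
   Context: $[n]=\{1<\dots<n\}$. The $n$'th letterplace ideal $L(n,P)$ is the ideal in $S=\Bbbk[x_{i,p}:(i,p)\in[n]\times P]$ generated by the monomials $x_{1,p_1}x_{2,p_2}\cdots x_{n,p_n}$ with $p_1\le p_2\le\cdots\le p_n$ in $P$. For $R\subseteq[n]\times P$, $\beta_{i,R}(L(n,P))=\dim_\Bbbk\mathrm{Tor}_i^S(L(n,P),\Bbbk)_R$, where the multidegree $R$ means the $0/1$ exponent vector with support $R$. The Betti number $\beta_{i,R}$ is said to be in the $(|R|-i)$-linear strand; since $L(n,P)$ is generated in degree $n$, its first linear strand is the $n$-linear strand. *)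

(* Defs.v *)
From mathcomp Require Import all_boot all_order all_algebra.
From mathcomp Require Import mpoly.

Set Implicit Arguments.
Unset Strict Implicit.
Unset Printing Implicit Defensive.

Import Order.TTheory GRing.Theory.
Local Open Scope ring_scope.

Section Resolution.

Variables (k : fieldType) (N : nat).

(* A multigraded resolution
     ... -> F_2 -> F_1 -> F_0 -> J -> 0
   of an ideal J of S = k[x_0, ..., x_(N-1)] by free S-modules of finite rank:
   F_i is the module of row vectors over S, its a-th basis vector has
   multidegree [res_deg i a], and [res_diff i : F_(i+1) -> F_i] and
   [res_aug : F_0 -> J] act by multiplication on the right.  The two
   homogeneity fields say that these maps preserve multidegrees. *)
Record mgfree_resolution (J : {mpoly k[N]} -> Prop) := MgFreeResolution {
  res_rank : nat -> nat;
  res_deg : forall i, 'I_(res_rank i) -> 'X_{1..N};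
  res_diff : forall i, 'M[{mpoly k[N]}]_(res_rank i.+1, res_rank i);
  res_aug : 'cV[{mpoly k[N]}]_(res_rank 0);
  res_diff_homog : forall i a b m,
    m \in msupp (res_diff i a b) -> (m + res_deg b)%MM = res_deg a;
  res_aug_homog : forall a m, m \in msupp (res_aug a 0) -> m = res_deg a;
  res_aug_image : forall f,
    J f <-> exists v : 'rV[{mpoly k[N]}]_(res_rank 0), f = (v *m res_aug) 0 0;
  res_exact0 : forall v : 'rV[{mpoly k[N]}]_(res_rank 0),
    v *m res_aug = 0 <-> exists w, v = w *m res_diff 0;
  res_exactS : forall i (v : 'rV[{mpoly k[N]}]_(res_rank i.+1)),
    v *m res_diff i = 0 <-> exists w, v = w *m res_diff i.+1
}.

Arguments res_deg {J} _ i _.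

Variables (J : {mpoly k[N]} -> Prop) (F : mgfree_resolution J).

(* Tensoring with k = S/(x_0, ..., x_(N-1)) turns F_i into the row vectors
   over k and replaces each entry of the differentials by its constant term.
   Subspaces in multidegree mu are given as row spaces; the one of
   [tor_chains i mu] is spanned by the basis vectors of degree mu. *)
Definition tor_diff (i : nat) : 'M[k]_(res_rank F i.+1, res_rank F i) :=
  map_mx (mcoeff 0%MM) (res_diff F i).

Definition tor_chains (i : nat) (mu : 'X_{1..N}) : 'M[k]_(res_rank F i) :=
  diag_mx (\row_a (res_deg F i a == mu)%:R).

Definition tor_cycles (i : nat) (mu : 'X_{1..N}) : 'M[k]_(res_rank F i) :=
  match i return 'M[k]_(res_rank F i) with
  | 0 => tor_chains 0 mu
  | i'.+1 => (tor_chains i'.+1 mu :&: kermx (tor_diff i'))%MS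
  end.

Definition tor_boundaries (i : nat) (mu : 'X_{1..N}) :
    'M[k]_(res_rank F i.+1, res_rank F i) :=
  tor_chains i.+1 mu *m tor_diff i.

(* dim_k Tor_i^S(J, k)_mu, where Tor is computed from the resolution F; the
   boundaries lie in the cycles, so the subtraction is not truncated. *)
Definition betti (i : nat) (mu : 'X_{1..N}) : nat :=
  (\rank (tor_cycles i mu) - \rank (tor_boundaries i mu))%N.

End Resolution.

Section Letterplace.

Variables (k : fieldType) (n : nat) (d : Order.disp_t) (P : finPOrderType d).

(* The variables x_(i,p) are numbered by the enumeration of [n] x P; the index
   set [n] = {1, ..., n} is represented by 'I_n = {0, ..., n-1}. *)
Notation nvars := #|{: 'I_n * P}|.

Definition lp_var (i : 'I_n) (p : P) : {mpoly k[nvars]} :=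
  'X_(enum_rank (i, p)).

Definition multichain (p : {ffun 'I_n -> P}) : bool :=
  [forall i : 'I_n, forall j : 'I_n, (i <= j)%N ==> (p i <= p j)%O].

Definition letterplace (f : {mpoly k[nvars]}) : Prop :=
  exists c : {ffun 'I_n -> P} -> {mpoly k[nvars]},
    f = \sum_(p | multichain p) c p * \prod_(i < n) lp_var i (p i).

Definition mdeg_set (R : {set 'I_n * P}) : 'X_{1..nvars} :=
  [multinom (enum_val v \in R : nat) | v < nvars].

Definition slice (R : {set 'I_n * P}) (j : 'I_n) : {set P} :=
  [set p | (j, p) \in R].

End Letterplace.

Arguments letterplace k n {d} P f.

(* Main.v *)
Require Import Defs.
From mathcomp Require Import all_boot all_order all_algebra.
From mathcomp Require Import mpoly.

(** Tor is symmetric in its two arguments, so the Betti number in degree [R] can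
    be computed from the Koszul complex instead of the given resolution: it is
    the dimension of the homology, in homological degree [i] and multidegree
    [R], of the Koszul complex with values in [J = L(n,P)].  A chain has a
    coefficient for each [A] in [R] with [#|A| = i] such that the monomial with
    support [R :\: A] lies in [J].

    For [i = #|R| - n] this monomial has degree [n], so it lies in [J] if and
    only if [R :\: A] is the graph of a multichain, and there are no chains in
    degree [i + 1].  The Betti number is therefore the dimension of a space of
    functions on the tuples in [R_1 x ... x R_n] that vanish at the tuples that
    are not multichains.  The cycle condition at a set that meets one column in
    two elements and each other column in one element relates the values at the
    two tuples contained in it: they are equal up to sign ([kbd_swap]).  As any
    tuple can be transformed into any other by changing entries one at a time, a
    cycle is determined by its value at one tuple ([top_cycle_eq0]).  If some
    tuple is not a multichain, then all cycles are zero ([betti_top_eq0]).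
    Otherwise the space has dimension at most one, and a choice of signs gives a
    nonzero cycle ([top_class_bd], [betti_top_eq1]).  Since all [R_j] are
    nonempty, all tuples are multichains exactly when the elements of [R_j] are
    below those of [R_(j+1)] for all [j].

    The comparison of the two computations of Tor ([koszul_tor]) holds for every
    resolution and every squarefree degree [R].  In squarefree degrees below [R]
    a graded free module is a family of subspaces of one space [k^r], and the
    resolution becomes a sequence of scalar matrices, exact in each degree.  The
    double complex formed by it and the Koszul complex has exact rows and
    columns, apart from the edges, and the classes are carried from one edge to
    the other along a staircase, one square at a time ([zigzag_step]). *)

Set Implicit Arguments.
Unset Strict Implicit.
Unset Printing Implicit Defensive.

Import GRing.Theory.

(** * Homogeneous matrices and their scalars *)

Section GradedMatrices.

Local Open Scope ring_scope.

Variables (k : fieldType) (N : nat).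
Notation S := {mpoly k[N]}.
Notation mdeg := 'X_{1..N}.

Definition homog_mx r s (dr : 'I_r -> mdeg) (ds : 'I_s -> mdeg)
    (M : 'M[S]_(r, s)) : Prop :=
  forall a b m, m \in msupp (M a b) -> (m + ds b)%MM = dr a.

(** Every entry of a homogeneous matrix is a scalar times the monomial forced by
    the degrees of its row and of its column; this is the matrix of scalars.
    Truncation of the subtraction does no harm: [scal_mx_le]. *)
Definition scal_mx r s (dr : 'I_r -> mdeg) (ds : 'I_s -> mdeg)
    (M : 'M[S]_(r, s)) : 'M[k]_(r, s) :=
  \matrix_(a, b) (M a b)@_(dr a - ds b).

(** The homogeneous elements of degree [mu] of a graded free module are the
    [\row_a (v_a x^(mu - deg a))] with [v] supported on the basis vectors of
    degree at most [mu].  Thus the parts of all degrees are subspaces of one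
    space [k^r], and multiplication by monomials becomes inclusion. *)
Definition below r (dr : 'I_r -> mdeg) mu (v : 'rV[k]_r) : Prop :=
  forall a, v 0 a != 0 -> (dr a <= mu)%MM.

Definition lift_mdeg r (dr : 'I_r -> mdeg) mu (v : 'rV[k]_r) : 'rV[S]_r :=
  \row_a (v 0 a *: 'X_[mu - dr a]).

Definition part_mdeg r (dr : 'I_r -> mdeg) mu (w : 'rV[S]_r) : 'rV[k]_r :=
  \row_a (if (dr a <= mu)%MM then (w 0 a)@_(mu - dr a) else 0).

Lemma below_lin r (dr : 'I_r -> mdeg) mu c v v' :
  below dr mu v -> below dr mu v' -> below dr mu (c *: v + v').
Proof.
move=> bv bv' a; rewrite !mxE.
have [v0|vn0 _] := eqVneq (v 0 a) 0; last exact: bv.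
by rewrite v0 mulr0 add0r; exact: bv'.
Qed.

Lemma part_below r (dr : 'I_r -> mdeg) mu w : below dr mu (part_mdeg dr mu w).
Proof. by move=> a; rewrite mxE; case: ifP => // _; rewrite eqxx. Qed.

Lemma lift_mdegK r (dr : 'I_r -> mdeg) mu v :
  below dr mu v -> part_mdeg dr mu (lift_mdeg dr mu v) = v.
Proof.
move=> bv; apply/rowP => a; rewrite !mxE mcoeffZ mcoeffX eqxx mulr1.
by case: ifPn => // nle; apply/esym/eqP; apply: contraNT nle => /bv.
Qed.

Section OneMatrix.

Variables (r s : nat) (dr : 'I_r -> mdeg) (ds : 'I_s -> mdeg).
Variable M : 'M[S]_(r, s).
Hypothesis homM : homog_mx dr ds M.

Lemma homog_mxE a b : M a b = scal_mx dr ds M a b *: 'X_[dr a - ds b].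
Proof.
apply/mpolyP => m; rewrite mcoeffZ mcoeffX mxE.
have [<-|ne_m] := eqVneq; first by rewrite mulr1.
rewrite mulr0; apply/eqP; rewrite mcoeff_eq0; apply: contra ne_m => /homM <-.
by rewrite addmK.
Qed.

Lemma scal_mx_le a b : scal_mx dr ds M a b != 0 -> (ds b <= dr a)%MM.
Proof. by rewrite mxE -mcoeff_msupp => /homM <-; apply: lem_addl. Qed.

Lemma below_scal mu v : below dr mu v -> below ds mu (v *m scal_mx dr ds M).
Proof.
move=> bv b; rewrite mxE => /eqP ne0; apply/negPn/negP => nle; case: ne0.
apply: big1 => a _; apply/eqP; apply: contraNT nle.
rewrite mulf_eq0 negb_or => /andP[/bv le_a /scal_mx_le le_b].
exact: lepm_trans le_b le_a.
Qed.

(** Together with [part_mdegM], this makes the passage to scalars a functor, so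
    that exactness over polynomials gives exactness in each degree. *)
Lemma lift_mdegM mu v : below dr mu v ->
  lift_mdeg dr mu v *m M = lift_mdeg ds mu (v *m scal_mx dr ds M).
Proof.
move=> bv; apply/rowP => b; rewrite !mxE scaler_suml.
apply: eq_bigr => a _; rewrite mxE homog_mxE.
have [->|nv] := eqVneq (v 0 a) 0; first by rewrite scale0r !mul0r scale0r.
have [->|nM] := eqVneq (scal_mx dr ds M a b) 0.
  by rewrite scale0r !mulr0 scale0r.
rewrite -scalerAl -scalerAr scalerA -mpolyXD; congr (_ *: 'X_[_]).
by rewrite addmBA ?submK ?scal_mx_le //; apply: bv.
Qed.

Lemma part_mdegM mu w :
  part_mdeg ds mu (w *m M) = part_mdeg dr mu w *m scal_mx dr ds M.
Proof.
apply/rowP => b; rewrite !mxE raddf_sum /=.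
case: ifPn => [le_b|nle]; last first.
  apply/esym/big1 => a _; rewrite mxE.
  case: ifP => [le_a|]; last by rewrite mul0r.
  have [->|/scal_mx_le le_b] := eqVneq (scal_mx dr ds M a b) 0.
    by rewrite mulr0.
  by rewrite (lepm_trans le_b le_a) in nle.
apply: eq_bigr => a _; rewrite mxE homog_mxE -scalerAr mcoeffZ mulrC.
have [->|/scal_mx_le le_ba] := eqVneq (scal_mx dr ds M a b) 0.
  by rewrite !mulr0.
congr (_ * _); case: ifPn => [le_a|nle_a].
  have -> : (mu - ds b = (mu - dr a) + (dr a - ds b))%MM.
    by rewrite addmBA ?submK.
  by rewrite addmC mcoeffMX.
apply/eqP; rewrite mcoeff_eq0; apply: contra nle_a.
rewrite mcoeff_msupp => ne0; rewrite -(submK le_b) -(submK le_ba).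
move: ne0; rewrite -mcoeff_msupp (perm_mem (msuppMX _ _)) => /mapP[m _ ->].
by rewrite -addmA (addmC m) addmA lem_addr.
Qed.

End OneMatrix.

End GradedMatrices.

(** * Squarefree degrees *)

Section SquarefreeDegrees.

Variable T : finType.
Implicit Types (A B : {set T}) (m : 'X_{1..#|T|}).

(** For [T := 'I_n * P] this is [mdeg_set]; the homological part of the proof
    works with variables indexed by any finite type. *)
Definition mset A : 'X_{1..#|T|} :=
  [multinom (enum_val v \in A : nat) | v < #|T|].

Lemma mset_rank A x : mset A (enum_rank x) = (x \in A).
Proof. by rewrite mnmE enum_rankK. Qed.

Lemma mset_lepP m A :
  reflect (forall x, (m (enum_rank x) <= (x \in A))%N) (m <= mset A)%MM.
Proof.
apply: (iffP mnm_lepP) => le_m x.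
  by have := le_m (enum_rank x); rewrite mset_rank.
by have := le_m (enum_val x); rewrite enum_valK mnmE.
Qed.

Lemma mset_le A B : (mset A <= mset B)%MM = (A \subset B).
Proof.
apply/mset_lepP/subsetP => le_AB x.
  by have := le_AB x; rewrite mset_rank; case: (x \in A); case: (x \in B).
by rewrite mset_rank; have := le_AB x; case: (x \in A) => // ->.
Qed.

Lemma mset_setD1 m A x :
  (m <= mset A)%MM -> m (enum_rank x) = 0%N -> (m <= mset (A :\ x))%MM.
Proof.
move=> /mset_lepP le_m mx0; apply/mset_lepP => y; rewrite !inE.
by have [->|_] := eqVneq y x; [rewrite mx0 | apply: le_m].
Qed.

Lemma mset_notin m A x :
  (m <= mset A)%MM -> x \notin A -> m (enum_rank x) = 0%N.
Proof. by move=> /mset_lepP/(_ x) + /negPf xA; rewrite xA leqn0 => /eqP. Qed.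

Lemma mset_eq m A : (m <= mset A)%MM ->
  (forall x, x \in A -> m (enum_rank x) != 0%N) -> m = mset A.
Proof.
move=> /mset_lepP le_m m_n0; apply/mnmP => i; rewrite -(enum_valK i) mset_rank.
have := le_m (enum_val i); have := m_n0 (enum_val i).
by case: (_ \in A) => [/(_ isT)|_]; case: (m _) => [|[]].
Qed.

End SquarefreeDegrees.

(** * The Koszul complex *)

Section Koszul.

Local Open Scope ring_scope.

Variables (k : fieldType) (T : finType) (key : T -> nat).
Hypothesis key_inj : injective key.
Implicit Types (A D : {set T}) (x y : T).

(** The sign of the Koszul differential for the order of the variables given by
    [key]; leaving the order free makes it possible to choose one adapted to the
    columns of [n] x P later. *)
Definition ksign x D : k := (-1) ^+ #|[set y in D | (key y < key x)%N]|.

Lemma ksign_sq x D : ksign x D * ksign x D = 1.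
Proof. by rewrite -expr2 sqrr_sign. Qed.

Lemma ksignU1 x y D : x \notin D -> ksign y (x |: D) =
  (if (key x < key y)%N then -1 else 1) * ksign y D.
Proof.
move=> xD; rewrite /ksign; case: ifP => lt_xy.
  rewrite (_ : [set _ in _ | _] = x |: [set z in D | (key z < key y)%N]).
    by rewrite cardsU1 !inE (negPf xD) /= exprS.
  by apply/setP => z; rewrite !inE; have [->|] := eqVneq z x; rewrite // lt_xy.
rewrite mul1r; congr (_ ^+ #|pred_of_set _|); apply/setP => z; rewrite !inE.
by have [->|] := eqVneq z x; rewrite //= lt_xy andbF.
Qed.

(** The reason why the Koszul differential squares to zero. *)
Lemma ksign_swap x y D : x != y -> x \notin D -> y \notin D ->
  ksign y D * ksign x (y |: D) = - (ksign x D * ksign y (x |: D)).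
Proof.
move=> ne_xy xD yD; rewrite !ksignU1 //.
have : key x != key y by rewrite inj_eq.
by case: ltngtP => // _ _; rewrite ?mul1r ?mulN1r !mulrN ?opprK mulrC.
Qed.

Notation kfam r := {ffun {set T} -> 'rV[k]_r}.

(** The Koszul differential in a fixed squarefree degree [R].  A chain is a
    family whose member at [A] is the coefficient of the exterior monomial
    [e_A]; it lies in degree [R :\: A] of the module, and since multiplication
    by a variable is an inclusion, only signs are left. *)
Definition kbd r (w : kfam r) : kfam r :=
  [ffun D : {set T} => \sum_(x | x \notin D) ksign x D *: w (x |: D)].

Definition kmul r s (w : kfam r) (M : 'M[k]_(r, s)) : kfam s :=
  [ffun D : {set T} => w D *m M].

Lemma kbd_lin r c (w w' : kfam r) : kbd (c *: w + w') = c *: kbd w + kbd w'.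
Proof.
apply/ffunP => D; rewrite !ffunE scaler_sumr -big_split /=.
by apply: eq_bigr => x _; rewrite !ffunE scalerDr !scalerA mulrC.
Qed.

Lemma kmul_lin r s c (w w' : kfam r) (M : 'M_(r, s)) :
  kmul (c *: w + w') M = c *: kmul w M + kmul w' M.
Proof. by apply/ffunP => D; rewrite !ffunE mulmxDl scalemxAl. Qed.

Lemma kbdD r (w w' : kfam r) : kbd (w + w') = kbd w + kbd w'.
Proof. by have := kbd_lin 1 w w'; rewrite !scale1r. Qed.

Lemma kmulD r s (w w' : kfam r) (M : 'M_(r, s)) :
  kmul (w + w') M = kmul w M + kmul w' M.
Proof. by have := kmul_lin 1 w w' M; rewrite !scale1r. Qed.

Lemma kbdB r (w w' : kfam r) : kbd (w - w') = kbd w - kbd w'.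
Proof. by rewrite addrC -scaleN1r kbd_lin scaleN1r addrC. Qed.

Lemma kmulB r s (w w' : kfam r) (M : 'M_(r, s)) :
  kmul (w - w') M = kmul w M - kmul w' M.
Proof. by rewrite addrC -scaleN1r kmul_lin scaleN1r addrC. Qed.

Lemma kbd_kmul r s (w : kfam r) (M : 'M_(r, s)) :
  kbd (kmul w M) = kmul (kbd w) M.
Proof.
apply/ffunP => D; rewrite !ffunE mulmx_suml; apply: eq_bigr => x _.
by rewrite !ffunE scalemxAl.
Qed.

Lemma kbd_kbd r (w : kfam r) : kbd (kbd w) = 0.
Proof.
apply/ffunP => D; rewrite !ffunE.
pose G x y : 'rV[k]_r := (ksign x D * ksign y (x |: D)) *: w (y |: (x |: D)).
transitivity (\sum_(x | x \notin D) \sum_(y | (y \notin D) && (y != x)) G x y).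
  apply: eq_bigr => x _; rewrite ffunE scaler_sumr; apply: eq_big => y.
    by rewrite !inE negb_or andbC.
  by rewrite scalerA.
pose lt x y := (key x < key y)%N.
transitivity (\sum_(x | x \notin D)
    (\sum_(y | (y \notin D) && lt x y) G x y
      + \sum_(y | (y \notin D) && lt y x) G x y)).
  apply: eq_bigr => x _; rewrite (bigID (lt x)) /=; congr (_ + _);
  apply: eq_bigl => y; rewrite -andbA; congr (_ && _);
  rewrite /lt -(inj_eq key_inj); by case: ltngtP.
rewrite big_split /= [X in X + _](exchange_big_dep (fun y => y \notin D)) //=;
  last by move=> x y _ /andP[].
rewrite -big_split /= big1 // => y yD.
rewrite (eq_bigl (fun x => (x \notin D) && lt x y)) => [|x]; last by rewrite yD.
rewrite -big_split /= big1 // => x /andP[xD lt_xy].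
(* The ordered pairs (x, y) and (y, x) cancel; comparing keys picks one of
   each, which keeps the argument valid in characteristic 2. *)
rewrite /G setUCA ksign_swap //; first by rewrite scaleNr addNr.
by apply: contraTneq lt_xy => ->; rewrite /lt ltnn.
Qed.

(** The contracting homotopy that multiplies the coordinate [b] by the exterior
    variable [e_x], where [v b = Some x]. *)
Definition khom r (v : 'I_r -> option T) (w : kfam r) : kfam r :=
  [ffun A : {set T} => \row_b
     if v b is Some x then
       if x \in A then ksign x (A :\ x) * w (A :\ x) 0 b else 0
     else 0].

Lemma kbdE r (w : kfam r) D b :
  kbd w D 0 b = \sum_(x | x \notin D) ksign x D * w (x |: D) 0 b.
Proof. by rewrite ffunE summxE; apply: eq_bigr => x _; rewrite mxE. Qed.

Lemma kbd_khom r (v : 'I_r -> option T) (w : kfam r) D b x :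
  kbd w = 0 -> v b = Some x -> kbd (khom v w) D 0 b = w D 0 b.
Proof.
move=> w0 vb; rewrite kbdE.
have [xD|xD] := boolP (x \in D); last first.
  rewrite (bigD1 x) //= !ffunE mxE vb setU11 setU1K // mulrA ksign_sq mul1r.
  rewrite big1 ?addr0 // => y /andP[yD ne_yx]; rewrite ffunE mxE vb !inE.
  by rewrite eq_sym (negPf ne_yx) (negPf xD) mulr0.
pose E := D :\ x; have xE : x \notin E by rewrite !inE eqxx.
have DE : D = x |: E by rewrite setD1K.
have := kbdE w E b; rewrite w0 ffunE mxE (bigD1 x) //= -DE.
move/esym/eqP; rewrite addr_eq0 => /eqP wE.
rewrite -[RHS]mul1r -(ksign_sq x E) -mulrA wE mulrN mulr_sumr -sumrN.
apply: eq_big => [y|y yD]; first by rewrite DE !inE negb_or andbC.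
have yE : y \notin E by apply: contra yD => yE; rewrite DE setU1r.
have ne_yx : y != x by apply: contraNneq yD => ->.
rewrite ffunE mxE vb !inE xD orbT.
have -> : (y |: D) :\ x = y |: E.
  apply/setP => z; rewrite !inE; have [->|] := eqVneq z x => //=.
  by rewrite orbF eq_sym (negPf ne_yx).
rewrite !mulrA -mulNr; congr (_ * _).
have := ksign_swap ne_yx yE xE.
rewrite -DE => /(congr1 (fun c => ksign x E * c)).
rewrite mulrA ksign_sq mul1r => ->.
by rewrite mulrN mulNr -!mulrA ksign_sq mulr1.
Qed.

Section Chains.

Variables (R : {set T}) (r : nat) (dr : 'I_r -> 'X_{1..#|T|}).

(** The Koszul [q]-chains in degree [R] with values in the graded free module
    whose basis has degrees [dr]. *)
Definition kchain q (w : kfam r) : Prop :=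
  forall A b, w A 0 b != 0 ->
    [/\ A \subset R, #|A| = q & (dr b <= mset (R :\: A))%MM].

Lemma kchain_lin q c w w' :
  kchain q w -> kchain q w' -> kchain q (c *: w + w').
Proof.
move=> cw cw' A b; rewrite !ffunE !mxE.
have [w0|wn0 _] := eqVneq (w A 0 b) 0; last exact: cw.
by rewrite w0 mulr0 add0r; exact: cw'.
Qed.

Lemma kchainB q w w' : kchain q w -> kchain q w' -> kchain q (w - w').
Proof. by move=> cw cw'; rewrite addrC -scaleN1r; apply: kchain_lin. Qed.

Lemma kchain_bd q w : kchain q.+1 w -> kchain q (kbd w).
Proof.
move=> cw D b; rewrite kbdE => /eqP ne0.
have [x /andP[xD wx]] : exists x, (x \notin D) && (w (x |: D) 0 b != 0).
  apply/existsP; apply: contra_notT ne0; rewrite negb_exists => /forallP w0.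
  apply: big1 => x xD; apply/eqP; rewrite mulf_eq0; apply/orP; right.
  by have := w0 x; rewrite xD negbK.
have [sAR cA le_b] := cw _ _ wx; split.
- exact: subset_trans (subsetUr _ _) sAR.
- by move: cA; rewrite cardsU1 xD add1n => -[].
- by apply: lepm_trans le_b _; rewrite mset_le setDS // subsetUr.
Qed.

(** A basis vector [b] contributes to degree [R] the chain complex of a simplex
    with vertices the [x] in [R] that do not divide its degree.  This is
    contractible unless there are no vertices, that is, [b] has degree [R]; then
    it is the field in homological degree 0, which the last hypothesis kills. *)
Lemma koszul_exact q w : kchain q w -> kbd w = 0 ->
    (forall b, dr b = mset R -> w set0 0 b = 0) ->
  exists2 u, kchain q.+1 u & w = kbd u.
Proof.
move=> cw w0 wR.
(* Any vertex of the simplex of [b] serves as the apex of the contraction. *)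
pose v b := [pick x in R | dr b (enum_rank x) == 0%N].
exists (khom v w).
  move=> A b; rewrite ffunE mxE /v; case: pickP => [x|_]; last by rewrite eqxx.
  case/andP=> xR /eqP bx0; case: ifP => [xA|]; last by rewrite eqxx.
  rewrite mulf_eq0 negb_or => /andP[_ /cw[sAR cA le_b]]; split.
  - by rewrite -(setD1K xA) subUset sub1set xR.
  - by rewrite (cardsD1 x) xA cA.
  - have -> : R :\: A = (R :\: (A :\ x)) :\ x; last exact: mset_setD1.
    apply/setP => y; rewrite !inE; have [->|] //= := eqVneq y x.
    by rewrite xA.
apply/ffunP => D; apply/rowP => b; case vb: (v b) => [x|].
  by rewrite (kbd_khom _ w0 vb).
rewrite kbdE big1 => [|y _]; last by rewrite ffunE mxE vb mulr0.
have {vb} b_n0 : forall x, x \in R -> dr b (enum_rank x) != 0%N.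
  move: vb; rewrite /v; case: pickP => // v0 _ x xR.
  by have := v0 x; rewrite xR => /= ->.
apply/eqP; apply/negPn/negP => wDb; have [sDR _ le_b] := cw _ _ wDb.
have D0 : D = set0.
  apply/setP => x; rewrite inE; apply/negP => xD.
  have /eqP := b_n0 x (subsetP sDR x xD); apply; apply: mset_notin le_b _.
  by rewrite inE xD.
move: wDb le_b; rewrite D0 setD0 => /eqP wDb /mset_eq/(_ b_n0)/wR; exact.
Qed.

End Chains.

End Koszul.

(** * Isomorphisms of subquotients *)

Section Subquotients.

Local Open Scope ring_scope.

Variable k : fieldType.

(** An isomorphism between the subquotients [X / X0] and [Y / Y0], given as a
    relation between representatives.  Diagram chases produce such relations
    directly, without choosing images, and they compose.  The third clause plays
    the parts of linearity, well-definedness and injectivity at once. *)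
Definition subquo_iso (U V : lmodType k)
    (X X0 : U -> Prop) (Y Y0 : V -> Prop) : Prop :=
  exists rho : U -> V -> Prop,
  [/\ forall u, X u -> exists2 v, Y v & rho u v,
      forall v, Y v -> exists2 u, X u & rho u v
    & forall c u v u' v', X u -> Y v -> rho u v -> X u' -> Y v' -> rho u' v' ->
        X0 (c *: u + u') <-> Y0 (c *: v + v')].

Lemma subquo_iso_trans (U V W : lmodType k) (X X0 : U -> Prop)
    (Y Y0 : V -> Prop) (Z Z0 : W -> Prop) :
  subquo_iso X X0 Y Y0 -> subquo_iso Y Y0 Z Z0 -> subquo_iso X X0 Z Z0.
Proof.
case=> [f [totf ontof okf]] [g [totg ontog okg]].
exists (fun u w => exists v, [/\ Y v, f u v & g v w]); split.
- move=> u /totf[v Yv fuv]; have [w Zw gvw] := totg v Yv.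
  by exists w => //; exists v.
- move=> w /ontog[v Yv gvw]; have [u Xu fuv] := ontof v Yv.
  by exists u => //; exists v.
move=> c u w u' w' Xu Zw [v [Yv fuv gvw]] Xu' Zw' [v' [Yv' fuv' gvw']].
exact: iff_trans (okf _ _ _ _ _ Xu Yv fuv Xu' Yv' fuv')
                 (okg _ _ _ _ _ Yv Zw gvw Yv' Zw' gvw').
Qed.

Variables (U : lmodType k) (X X0 : U -> Prop).
Variables (s r r' : nat) (Y : 'M[k]_(r, s)) (Y0 : 'M[k]_(r', s)).
Hypothesis isoXY :
  subquo_iso X X0 (fun y : 'rV_s => (y <= Y)%MS)
    (fun y : 'rV_s => (y <= Y0)%MS).

Lemma subquo_iso_eq0 :
  (forall u, X u -> X0 u) -> (\rank Y - \rank Y0)%N = 0%N.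
Proof.
have [rho [_ onto ok]] := isoXY => XX0; apply/eqP; rewrite subn_eq0.
apply/mxrankS/row_subP => i; have [u Xu ru] := onto _ (row_sub i Y).
have := ok 0 u _ u _ Xu (row_sub i Y) ru Xu (row_sub i Y) ru.
by rewrite !scale0r !add0r => -[+ _]; apply; apply: XX0.
Qed.

Lemma subquo_iso_eq1 u0 : (Y0 <= Y)%MS -> X u0 -> ~ X0 u0 ->
  (forall u, X u -> exists c, X0 (c *: u0 + u)) -> (\rank Y - \rank Y0)%N = 1%N.
Proof.
have [rho [tot onto ok]] := isoXY => sY0Y Xu0 X0u0 gen.
have [v0 Yv0 rv0] := tot _ Xu0.
have Y0v0 : ~~ (v0 <= Y0)%MS.
  apply/negP => Y0v0; apply: X0u0.
  have := ok 0 _ _ _ _ Xu0 Yv0 rv0 Xu0 Yv0 rv0.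
  by rewrite !scale0r !add0r => -[_]; apply.
have sYv0 : (Y <= Y0 + v0)%MS.
  apply/row_subP => i; have [u Xu ru] := onto _ (row_sub i Y).
  have [c X0c] := gen _ Xu.
  have [/(_ X0c) Y0c _] := ok c _ _ _ _ Xu0 Yv0 rv0 Xu (row_sub i Y) ru.
  have -> : row i Y = (c *: v0 + row i Y) + (- c) *: v0.
    by rewrite scaleNr addrAC subrr add0r.
  by rewrite addmx_sub_adds // scalemx_sub.
have ltY : (\rank Y0 < \rank Y)%N.
  rewrite ltnNge; apply: contra Y0v0 => le_r; apply: submx_trans Yv0 _.
  by have [_ <-] := mxrank_leqif_sup sY0Y; rewrite eqn_leq le_r mxrankS.
have leY : (\rank Y <= \rank Y0 + 1)%N.
  apply: leq_trans (mxrankS sYv0) _.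
  by apply: leq_trans (mxrank_adds_leqif _ _) _; rewrite leq_add2l rank_leq_row.
by apply/eqP; rewrite eqn_leq subn_gt0 ltY andbT leq_subLR.
Qed.

End Subquotients.

(** * Tor as Koszul homology *)

Section TorKoszul.

Local Open Scope ring_scope.

Variables (k : fieldType) (T : finType) (key : T -> nat).
Hypothesis key_inj : injective key.
Variables (J : {mpoly k[#|T|]} -> Prop) (F : mgfree_resolution J).
Variable R : {set T}.
Implicit Types (A D : {set T}).

Notation kfam r := {ffun {set T} -> 'rV[k]_r}.
Notation kbd := (kbd key).
Notation kchain := (kchain R).
Notation deg i := (@res_deg k #|T| J F i).
Notation rk := (res_rank F).

Definition scal_diff i : 'M[k]_(rk i.+1, rk i) :=
  scal_mx (deg i.+1) (deg i) (res_diff F i).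

(** The ring as a free module of rank 1, generated in degree 0. *)
Definition deg_ring (a : 'I_1) : 'X_{1..#|T|} := 0%MM.

Definition scal_aug : 'M[k]_(rk 0, 1) := scal_mx (deg 0) deg_ring (res_aug F).

Lemma homog_diff i : homog_mx (deg i.+1) (deg i) (res_diff F i).
Proof. exact: res_diff_homog. Qed.

Lemma homog_aug : homog_mx (deg 0) deg_ring (res_aug F).
Proof. by move=> a b m; rewrite ord1 addm0 => /res_aug_homog. Qed.

(** To test a row of the product it is enough to work in the degree of that
    basis vector. *)
Lemma scal_diffM i : scal_diff i.+1 *m scal_diff i = 0.
Proof.
apply/row_matrixP => a; rewrite row_mul row0 rowE.
set e : 'rV_ _ := delta_mx 0 a.
have be : below (deg i.+2) (deg i.+2 a) e.
  move=> b; rewrite !mxE /=; case: (eqVneq b a) => [->|_]; last by rewrite eqxx.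
  by rewrite lepm_refl.
rewrite -(lift_mdegK be) -(part_mdegM (homog_diff (i := i.+1))).
rewrite -(part_mdegM (homog_diff (i := i))).
have [_ ->] :=
  res_exactS (lift_mdeg (deg i.+2) (deg i.+2 a) e *m res_diff F i.+1).
  by apply/rowP => b; rewrite !mxE mcoeff0 if_same.
by eexists.
Qed.

Lemma scal_augM : scal_diff 0 *m scal_aug = 0.
Proof.
apply/row_matrixP => a; rewrite row_mul row0 rowE.
set e : 'rV_ _ := delta_mx 0 a.
have be : below (deg 1) (deg 1%N a) e.
  move=> b; rewrite !mxE /=; case: (eqVneq b a) => [->|_]; last by rewrite eqxx.
  by rewrite lepm_refl.
rewrite -(lift_mdegK be) -(part_mdegM (homog_diff (i := 0))).
rewrite -(part_mdegM homog_aug).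
have [_ ->] := res_exact0 (lift_mdeg (deg 1) (deg 1%N a) e *m res_diff F 0).
  by apply/rowP => b; rewrite !mxE mcoeff0 if_same.
by eexists.
Qed.

Lemma scal_diff_exact i mu v : below (deg i.+1) mu v -> v *m scal_diff i = 0 ->
  exists2 u, below (deg i.+2) mu u & v = u *m scal_diff i.+1.
Proof.
move=> bv v0.
have [+ _] := res_exactS (lift_mdeg (deg i.+1) mu v); case=> [|u vu].
  rewrite (lift_mdegM (homog_diff (i := i)) bv) -/(scal_diff i) v0.
  by apply/rowP => b; rewrite !mxE scale0r.
exists (part_mdeg (deg i.+2) mu u); first exact: part_below.
by rewrite -(lift_mdegK bv) vu (part_mdegM (homog_diff (i := i.+1))).
Qed.

Lemma scal_aug_exact mu v : below (deg 0) mu v -> v *m scal_aug = 0 ->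
  exists2 u, below (deg 1) mu u & v = u *m scal_diff 0.
Proof.
move=> bv v0.
have [+ _] := res_exact0 (lift_mdeg (deg 0) mu v); case=> [|u vu].
  rewrite (lift_mdegM homog_aug bv) -/scal_aug v0.
  by apply/rowP => b; rewrite !mxE scale0r.
exists (part_mdeg (deg 1) mu u); first exact: part_below.
by rewrite -(lift_mdegK bv) vu (part_mdegM (homog_diff (i := 0))).
Qed.

Lemma scal_aug_onto mu (c : 'rV_1) : J 'X_[mu] ->
  exists2 v, below (deg 0) mu v & c = v *m scal_aug.
Proof.
move=> /(res_aug_image F)[v Xv].
exists (c 0 0 *: part_mdeg (deg 0) mu v).
  rewrite -[_ *: _]addr0; apply: below_lin; first exact: part_below.
  by move=> a; rewrite mxE eqxx.
rewrite -scalemxAl -(part_mdegM homog_aug); apply/rowP => b.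
rewrite !mxE !ord1 /deg_ring subm0.
have -> : (0 <= mu)%MM by apply/mnm_lepP => x; rewrite mnm0E.
by rewrite !mxE in Xv *; rewrite -Xv mcoeffX eqxx mulr1.
Qed.

Lemma scal_aug_image mu v : below (deg 0) mu v -> (v *m scal_aug) 0 0 != 0 ->
  J 'X_[mu].
Proof.
move=> bv ne0; apply/(res_aug_image F).
exists (((v *m scal_aug) 0 0)^-1%:MP *: lift_mdeg (deg 0) mu v).
rewrite -scalemxAl (lift_mdegM homog_aug bv) -/scal_aug.
move: (v *m scal_aug) ne0 => c c0.
by rewrite !mxE /deg_ring subm0 mul_mpolyC scalerA mulVf // scale1r.
Qed.

Lemma kchain_below r (dr : 'I_r -> 'X_{1..#|T|}) q (w : kfam r) A :
  kchain dr q w -> below dr (mset (R :\: A)) (w A).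
Proof. by move=> cw a /cw[]. Qed.

Lemma kchain0 r (dr : 'I_r -> 'X_{1..#|T|}) q (w : kfam r) A :
  kchain dr q w -> ~~ ((A \subset R) && (#|A| == q)) -> w A = 0.
Proof.
move=> cw notA; apply/rowP => b; rewrite mxE; apply/eqP.
by apply: contraNT notA => /cw[-> -> _]; rewrite eqxx.
Qed.

(** Exactness of a row of free modules in every degree passes to Koszul chains,
    which are finite families of elements of various degrees. *)
Lemma kchain_lift r s (ds : 'I_s -> 'X_{1..#|T|}) (M : 'M[k]_(s, r))
    q (w : kfam r) :
    (forall A, A \subset R -> #|A| = q ->
       exists2 u, below ds (mset (R :\: A)) u & w A = u *m M) ->
    (forall A, ~~ ((A \subset R) && (#|A| == q)) -> w A = 0) ->
  exists2 u, kchain ds q u & w = kmul u M.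
Proof.
move=> onto w0.
have /fin_all_exists[u uP] : forall A, exists u : 'rV[k]_s,
    (forall b, u 0 b != 0 ->
       [/\ A \subset R, #|A| = q & (ds b <= mset (R :\: A))%MM])
    /\ w A = u *m M.
  move=> A; have [/andP[sAR /eqP cA]|notA] :=
    boolP ((A \subset R) && (#|A| == q)).
    by have [u bu wu] := onto A sAR cA; exists u; split => // b /bu.
  by exists 0; split=> [b|]; rewrite ?mxE ?eqxx // mul0mx w0.
exists [ffun A => u A].
  by move=> A b; rewrite ffunE; have [uA _] := uP A; apply: uA.
by apply/ffunP => A; rewrite !ffunE; have [] := uP A.
Qed.

Lemma kchain_diff i q w :
  kchain (deg i.+1) q w -> kchain (deg i) q (kmul w (scal_diff i)).
Proof.
move=> cw A b; rewrite ffunE => ne0.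
have [/andP[-> /eqP->]|notA] :=
  boolP ((A \subset R) && (#|A| == q)); last first.
  by rewrite (kchain0 cw notA) mul0mx mxE eqxx in ne0.
by split=> //; exact: (below_scal (@homog_diff i) (kchain_below cw)).
Qed.

(** The resolution augmented by the ring in place of its submodule [J]: the
    predecessor of [F_p], with the map to it.  It lets the step from 0 to 1 in
    the zigzag below be treated like the others. *)
Definition prev_rk p := if p is i.+1 then rk i else 1%N.

Definition scal_prev p : 'M[k]_(rk p, prev_rk p) :=
  match p with 0 => scal_aug | i.+1 => scal_diff i end.

(** The basis vectors of degree [R] of the predecessor.  There are none for
    [p = 0]: what precedes [F_0] is the ideal, whose Koszul homology is to be
    computed and not to be killed. *)
Definition prev_top p : pred 'I_(prev_rk p) :=
  match p with 0 => pred0 | i.+1 => [pred b | deg i b == mset R] end.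

Lemma scal_prevM p : scal_diff p *m scal_prev p = 0.
Proof. by case: p => [|i]; [apply: scal_augM | apply: scal_diffM]. Qed.

Lemma scal_prev_exact p mu v : below (deg p) mu v -> v *m scal_prev p = 0 ->
  exists2 u, below (deg p.+1) mu u & v = u *m scal_diff p.
Proof.
by case: p v => [|i] v; [apply: scal_aug_exact | apply: scal_diff_exact].
Qed.

Lemma kfam_exact p q w : kchain (deg p) q w -> kmul w (scal_prev p) = 0 ->
  exists2 u, kchain (deg p.+1) q u & w = kmul u (scal_diff p).
Proof.
move=> cw w0; apply: kchain_lift => [A _ _|A notA]; last exact: kchain0 cw notA.
apply: scal_prev_exact; first exact: kchain_below cw.
by move/ffunP/(_ A): w0; rewrite !ffunE.
Qed.

Lemma kmul_prev p (w : kfam (rk p.+1)) :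
  kmul (kmul w (scal_diff p)) (scal_prev p) = 0.
Proof. by apply/ffunP => A; rewrite !ffunE -mulmxA scal_prevM mulmx0. Qed.

(** Tor of [J] and [k] is computed by the double complex of the Koszul
    [q]-chains with values in [F_p].  A class of total degree [p + q] can be
    represented by an element [w] at the place (p, q) if and only if the image
    of [w] at (p - 1, q) is a Koszul boundary.  By [koszul_exact] the two
    equations stated here say this for [p > 0]; for [p = 0] they say that [w]
    maps to a cycle with values in [J]. *)
Definition zigzag p q (w : kfam (rk p)) : Prop :=
  [/\ kchain (deg p) q w, kbd (kmul w (scal_prev p)) = 0
    & forall b, prev_top b -> kmul w (scal_prev p) set0 0 b = 0].

(** The elements that represent zero: sums of a vertical and of a horizontal
    boundary. *)
Definition zigzag_bd p q (w : kfam (rk p)) : Prop :=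
  exists v u, [/\ kchain (deg p) q.+1 v, kchain (deg p.+1) q u
    & w = kbd v + kmul u (scal_diff p)].

Arguments zigzag : clear implicits.
Arguments zigzag_bd : clear implicits.

Lemma kbd_top r (dr : 'I_r -> 'X_{1..#|T|}) q (w : kfam r) b :
  kchain dr q w -> dr b = mset R -> kbd w set0 0 b = 0.
Proof.
move=> cw bR; rewrite kbdE big1 // => x _; apply/eqP.
rewrite mulf_eq0; apply/orP; right; apply/negPn/negP => /cw[sAR _].
rewrite bR mset_le => /subsetP/(_ x); rewrite !inE eqxx /= => /(_ _)/negP.
by apply => //; rewrite (subsetP sAR) // !inE eqxx.
Qed.

Lemma kchain_set0 r (dr : 'I_r -> 'X_{1..#|T|}) q (w : kfam r) :
  kchain dr q.+1 w -> w set0 = 0.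
Proof. by move=> cw; apply: kchain0 cw _; rewrite cards0 andbF. Qed.

(** One step of the staircase through the double complex: [w] and [w'] represent
    the same class if the Koszul boundary of [w] is the image of [w'].  Totality
    uses the exactness of [F], surjectivity that of the Koszul complex. *)
Lemma zigzag_step p q : subquo_iso (zigzag p q.+1) (zigzag_bd p q.+1)
  (zigzag p.+1 q) (zigzag_bd p.+1 q).
Proof.
exists (fun w w' => kbd w = kmul w' (scal_diff p)); split.
- move=> w [cw wbd wtop].
  have [||w' cw' ww'] := @kfam_exact p q (kbd w); first exact: kchain_bd.
    by rewrite -kbd_kmul.
  exists w' => //; split=> //=; first by rewrite -ww' kbd_kbd.
  by move=> b /eqP bR; rewrite -ww'; apply: kbd_top cw bR.
- move=> w' [cw' w'bd w'top].
  have [b bR|w cw ww'] := koszul_exact key_inj (kchain_diff cw') w'bd.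
    by apply: w'top; rewrite /= bR.
  exists w => //; split=> //; first by rewrite kbd_kmul -ww' kmul_prev.
  by move=> b _; rewrite ffunE (kchain_set0 cw) mul0mx mxE.
move=> c w w' w1 w1' [cw _ _] [cw' _ _] ww' [cw1 _ _] [cw1' _ _] ww1'.
have := kchain_lin (c := c) cw cw1; have := kchain_lin (c := c) cw' cw1'.
have : kbd (c *: w + w1) = kmul (c *: w' + w1') (scal_diff p).
  by rewrite kbd_lin kmul_lin ww' ww1'.
move: (c *: w + w1) (c *: w' + w1').
move=> {cw cw' ww' cw1 cw1' ww1'}w {}w' ww' cw' cw.
split=> [[v [u [cv cu wE]]]|[u [t [cu ct w'E]]]].
  have [||t ct tE] := @kfam_exact p.+1 q (w' - kbd u).
  - by apply: kchainB => //; apply: kchain_bd.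
  - by rewrite kmulB -kbd_kmul -ww' wE kbdD kbd_kbd // add0r subrr.
  by exists u, t; split=> //; rewrite -tE addrC subrK.
have [||b _|v cv vE] := @koszul_exact _ _ _ key_inj R _ (deg p) q.+1
  (w - kmul u (scal_diff p)).
- by apply: kchainB => //; apply: kchain_diff.
- rewrite kbdB ww' w'E kbd_kmul kmulD.
  by rewrite (kmul_prev (p := p.+1)) addr0 subrr.
- by rewrite (kchain_set0 (kchainB cw (kchain_diff cu))) mxE.
by exists v, u; split=> //; rewrite -vE subrK.
Qed.


(** The Koszul [q]-chains in degree [R] with values in [J].  The part of [J] in
    degree [R :\: A] is 0 unless the monomial lies in [J], when it is [k]. *)
Definition ideal_chain q (m : kfam 1) : Prop :=
  forall A, m A 0 0 != 0 ->
    [/\ A \subset R, #|A| = q & J 'X_[mset (R :\: A)]].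

Definition ideal_cycle q m : Prop := ideal_chain q m /\ kbd m = 0.

Definition ideal_boundary q m : Prop :=
  exists2 m', ideal_chain q.+1 m' & m = kbd m'.

Lemma ideal_chain_aug q w :
  kchain (deg 0) q w -> ideal_chain q (kmul w scal_aug).
Proof.
move=> cw A; rewrite ffunE => ne0.
have [/andP[-> /eqP->]|notA] :=
  boolP ((A \subset R) && (#|A| == q)); last first.
  by rewrite (kchain0 cw notA) mul0mx mxE eqxx in ne0.
by split=> //; apply: scal_aug_image ne0; apply: kchain_below cw.
Qed.

Lemma ideal_chain_lift q m : ideal_chain q m ->
  exists2 w, kchain (deg 0) q w & m = kmul w scal_aug.
Proof.
move=> cm; apply: kchain_lift => A.
  move=> _ _; have [m0|/cm[_ _ JA]] := eqVneq (m A 0 0) 0; last first.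
    exact: scal_aug_onto.
  exists 0; first by move=> b; rewrite mxE eqxx.
  by rewrite mul0mx; apply/rowP => b; rewrite ord1 m0 mxE.
move=> notA; apply/rowP => b; rewrite ord1 mxE; apply/eqP.
by apply: contraNT notA => /cm[-> -> _]; rewrite eqxx.
Qed.

(** At the place (0, q) the classes are the Koszul homology of [J], because
    [F_0] maps onto [J] with kernel the image of [F_1]. *)
Lemma zigzag_first q : subquo_iso (ideal_cycle q) (ideal_boundary q)
  (zigzag 0 q) (zigzag_bd 0 q).
Proof.
exists (fun m w => m = kmul w scal_aug); split.
- move=> m [cm m0]; have [w cw mw] := ideal_chain_lift cm.
  by exists w => //; split=> //=; rewrite -mw.
- move=> w [cw w0 _]; exists (kmul w scal_aug) => //; split=> //.
  exact: ideal_chain_aug.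
move=> c m w m1 w1 _ [cw _ _] mw _ [cw1 _ _] mw1.
have := kchain_lin (c := c) cw cw1.
have : c *: m + m1 = kmul (c *: w + w1) scal_aug by rewrite kmul_lin mw mw1.
move: (c *: m + m1) (c *: w + w1) => {cw mw cw1 mw1 w1 m1}m {}w mw cw.
split=> [[m' cm' mm']|[v [u [cv cu wE]]]].
  have [v cv m'v] := ideal_chain_lift cm'.
  have [||u cu uE] := @kfam_exact 0 q (w - kbd v).
  - by apply: kchainB => //; apply: kchain_bd.
  - by rewrite kmulB -kbd_kmul -mw mm' m'v subrr.
  by exists v, u; split=> //; rewrite -uE addrC subrK.
exists (kmul v scal_aug); first exact: ideal_chain_aug.
rewrite mw wE kmulD kbd_kmul.
by have /= -> := kmul_prev (p := 0) u; rewrite addr0.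
Qed.

Notation top := (mset R).

Lemma tor_chainsE i (v : 'rV_(rk i)) b :
  (v *m tor_chains F i top) 0 b = v 0 b * (deg i b == top)%:R.
Proof. by rewrite mul_mx_diag !mxE. Qed.

Lemma tor_chainsP i (v : 'rV_(rk i)) :
  reflect (v *m tor_chains F i top = v) (v <= tor_chains F i top)%MS.
Proof.
apply: (iffP idP) => [/submxP[u ->]|<-]; last exact: submxMl.
by apply/rowP => b; rewrite !tor_chainsE -mulrA -natrM mulnb andbb.
Qed.

Lemma below_top i (v : 'rV_(rk i)) :
  (v <= tor_chains F i top)%MS -> below (deg i) top v.
Proof.
move/tor_chainsP => <- b; rewrite tor_chainsE.
by case: (deg i b =P top) => [->|_]; rewrite ?lepm_refl // mulr0 eqxx.
Qed.

Lemma tor_diffE i a b :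
  tor_diff F i a b = scal_diff i a b * (deg i.+1 a == deg i b)%:R.
Proof.
rewrite mxE (homog_mxE (@homog_diff i)) mcoeffZ mcoeffX -/(scal_diff i).
have [->|/(scal_mx_le (@homog_diff i)) le_ba] := eqVneq (scal_diff i a b) 0.
  by rewrite !mul0r.
congr (_ * _%:R); congr nat_of_bool; apply/eqP/eqP => [ab0|->].
  by rewrite -(submK le_ba) ab0 add0m.
by apply/mnmP => x; rewrite !mnmE subnn.
Qed.

(** Projection to the basis vectors of degree [R] turns the differential in
    degree [R] into the one of the resolution tensored with [k]. *)
Lemma tor_chains_diff i (v : 'rV_(rk i.+1)) : below (deg i.+1) top v ->
  v *m scal_diff i *m tor_chains F i top
    = v *m tor_chains F i.+1 top *m tor_diff F i.
Proof.
move=> bv; apply/rowP => b; rewrite tor_chainsE !mxE mulr_suml.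
apply: eq_bigr => a _; rewrite tor_chainsE tor_diffE -!mulrA.
have [->|/bv le_a] := eqVneq (v 0 a) 0; first by rewrite !mul0r.
congr (_ * _); rewrite mulrCA.
have [->|/(scal_mx_le (@homog_diff i)) le_ba] := eqVneq (scal_diff i a b) 0.
  by rewrite !mul0r.
congr (_ * _); rewrite -natrM mulnb; congr (_%:R); congr nat_of_bool.
apply/eqP/andP => [bR|[/eqP <- /eqP -> //]].
have -> : deg i.+1 a = top.
  apply/mnmP => x; apply/eqP; rewrite eqn_leq (mnm_lepP le_a).
  by rewrite -bR (mnm_lepP le_ba).
by rewrite bR !eqxx.
Qed.

Lemma tor_boundaries_sub i :
  (tor_boundaries F i top <= tor_cycles F i top)%MS.
Proof.
apply/row_subP => a; set v := row a _.
have [u bu ->] : exists2 u, below (deg i.+1) top u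
    & v = u *m scal_diff i *m tor_chains F i top.
  have rC := row_sub a (tor_chains F i.+1 top).
  exists (row a (tor_chains F i.+1 top)); first exact: below_top.
  rewrite tor_chains_diff; last exact: below_top.
  by rewrite /v row_mul; move/tor_chainsP: rC => ->.
case: i {a v} u bu => [|i] u bu; first exact: submxMl.
rewrite sub_capmx submxMl; apply/sub_kermxP.
rewrite -tor_chains_diff; last exact: (below_scal (@homog_diff i.+1)).
by rewrite -[u *m _ *m _]mulmxA scal_diffM mulmx0 mul0mx.
Qed.

Lemma kbd_deg0 r (w : kfam r) : (forall A, A != set0 -> w A = 0) -> kbd w = 0.
Proof.
move=> w0; apply/ffunP => D; rewrite !ffunE big1 // => x _.
by rewrite w0 ?scaler0 //; apply/set0Pn; exists x; rewrite setU11.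
Qed.

Lemma kchain0P r (dr : 'I_r -> 'X_{1..#|T|}) (w : kfam r) :
  kchain dr 0 w <-> (forall A, A != set0 -> w A = 0) /\ below dr top (w set0).
Proof.
split=> [cw|[w0 b0] A b ne0].
  split=> [A A0|].
    by apply: (kchain0 cw); rewrite cards_eq0 (negPf A0) andbF.
  by have := kchain_below (A := set0) cw; rewrite setD0.
have [A0|/w0 wA] := eqVneq A set0; last by rewrite wA mxE eqxx in ne0.
by rewrite A0 sub0set cards0 setD0; split=> //; apply: b0; rewrite -A0.
Qed.

Definition kfam_at0 r (x : 'rV[k]_r) : kfam r :=
  [ffun A => if A == set0 then x else 0].

Lemma kfam_at0_chain i (x : 'rV_(rk i)) :
  (x <= tor_chains F i top)%MS -> kchain (deg i) 0 (kfam_at0 x).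
Proof.
move=> xC; apply/kchain0P; split=> [A /negPf A0|]; first by rewrite ffunE A0.
by rewrite ffunE eqxx; apply: below_top.
Qed.

Lemma tor_cyclesP i (v : 'rV_(rk i)) : below (deg i) top v ->
  (v *m tor_chains F i top <= tor_cycles F i top)%MS
    <-> (forall b, prev_top b -> (v *m scal_prev i) 0 b = 0).
Proof.
case: i v => [|i] v bv; first by split=> // _; apply: submxMl.
rewrite sub_capmx submxMl /=; split=> [/sub_kermxP v0 b /eqP bR|v0].
  have := tor_chainsE (v *m scal_diff i) b.
  by rewrite tor_chains_diff // v0 mxE bR eqxx mulr1.
apply/sub_kermxP; rewrite -tor_chains_diff //; apply/rowP => b.
rewrite tor_chainsE [RHS]mxE; case: (deg i b =P top) => [/eqP/v0->|].
  by rewrite mul0r.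
by rewrite mulr0.
Qed.

Lemma kmul_deg0 r s (dr : 'I_r -> 'X_{1..#|T|}) (w : kfam r) (M : 'M_(r, s)) :
  kchain dr 0 w -> kbd (kmul w M) = 0.
Proof.
move=> /kchain0P[w0 _]; apply: kbd_deg0 => A /w0 wA.
by rewrite ffunE wA mul0mx.
Qed.

(** At the place (i, 0) every chain is a Koszul cycle, and the boundaries of
    1-chains are the elements without component in degree [R], so that passing
    to classes amounts to tensoring with [k]. *)
Lemma zigzag_last i : subquo_iso (zigzag i 0) (zigzag_bd i 0)
  (fun x : 'rV_(rk i) => (x <= tor_cycles F i top)%MS)
  (fun x : 'rV_(rk i) => (x <= tor_boundaries F i top)%MS).
Proof.
exists (fun (w : kfam (rk i)) x => x = w set0 *m tor_chains F i top); split.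
- move=> w [cw _ wtop]; exists (w set0 *m tor_chains F i top) => //.
  have /kchain0P[_ b0] := cw; apply/(tor_cyclesP b0) => b /wtop.
  by rewrite ffunE.
- move=> x cx; have xC : (x <= tor_chains F i top)%MS.
    by case: i x cx => [|i] x //=; rewrite sub_capmx => /andP[].
  have x0 : kfam_at0 x set0 = x by rewrite ffunE eqxx.
  exists (kfam_at0 x); last by rewrite x0; apply/esym/tor_chainsP.
  split; first exact: kfam_at0_chain.
    by apply: kmul_deg0; apply: kfam_at0_chain.
  rewrite ffunE x0; apply/(tor_cyclesP (below_top xC)).
  by move/tor_chainsP: xC => ->.
move=> c w x w1 x1 [cw _ _] _ xw [cw1 _ _] _ x1w1.
have := kchain_lin (c := c) cw cw1.
have : c *: x + x1 = (c *: w + w1) set0 *m tor_chains F i top.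
  by rewrite !ffunE mulmxDl -scalemxAl xw x1w1.
move: (c *: x + x1) (c *: w + w1) => {xw x1w1 x x1 cw cw1 w1}x {}w -> cw.
split=> [[v [u [cv cu ->]]]|/submxP[t]].
  have /kchain0P[_ u0] := cu.
  have [kv0 E] : kbd v set0 *m tor_chains F i top = 0
      /\ (kbd v + kmul u (scal_diff i)) set0
         = kbd v set0 + u set0 *m scal_diff i.
    split; last by rewrite ffunE [kmul _ _ _]ffunE.
    apply/rowP => b; rewrite tor_chainsE [RHS]mxE.
    case: (deg i b =P top) => [bR|]; last by rewrite mulr0.
    by rewrite (kbd_top cv bR) mul0r.
  rewrite E mulmxDl kv0 add0r tor_chains_diff // -mulmxA.
  exact: submxMl.
rewrite mulmxA => wt; set y := t *m tor_chains F i.+1 top in wt.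
have yC : (y <= tor_chains F i.+1 top)%MS by apply: submxMl.
have cu := kfam_at0_chain yC; have cd := kchainB cw (kchain_diff cu).
have [|b bR|v cv wE] := koszul_exact key_inj cd.
- rewrite kbdB (kmul_deg0 _ cu) subr0; apply: kbd_deg0 => A.
  by have /kchain0P[+ _] := cw; apply.
- have /rowP/(_ b) : (w - kmul (kfam_at0 y) (scal_diff i)) set0
                        *m tor_chains F i top = 0.
    rewrite !ffunE eqxx mulmxBl wt tor_chains_diff; last exact: below_top.
    by move/tor_chainsP: yC => ->; rewrite subrr.
  by rewrite tor_chainsE bR eqxx mulr1 [RHS]mxE.
by exists v, (kfam_at0 y); split=> //; rewrite -wE subrK.
Qed.

(** Tor does not depend on how it is computed: in a squarefree degree [R] the
    homology of [F] tensored with [k] is the Koszul homology of [J]. *)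
Theorem koszul_tor i : subquo_iso (ideal_cycle i) (ideal_boundary i)
  (fun x : 'rV_(rk i) => (x <= tor_cycles F i top)%MS)
  (fun x : 'rV_(rk i) => (x <= tor_boundaries F i top)%MS).
Proof.
suff reach p q :
    subquo_iso (ideal_cycle (p + q)) (ideal_boundary (p + q))
               (zigzag p q) (zigzag_bd p q).
  have := reach i 0%N; rewrite addn0 => /subquo_iso_trans; apply.
  exact: zigzag_last.
elim: p q => [|p IHp] q; first exact: zigzag_first.
by rewrite addSnnS; apply: subquo_iso_trans (IHp q.+1) (zigzag_step p q).
Qed.

Corollary betti_eq0 i : (forall m, ideal_cycle i m -> ideal_boundary i m) ->
  betti F i top = 0%N.
Proof. exact: subquo_iso_eq0 (koszul_tor i). Qed.

Corollary betti_eq1 i m0 : ideal_cycle i m0 -> ~ ideal_boundary i m0 ->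
    (forall m, ideal_cycle i m -> exists c, ideal_boundary i (c *: m0 + m)) ->
  betti F i top = 1%N.
Proof.
move=> cm0 bm0 gen.
exact: (subquo_iso_eq1 (koszul_tor i) (tor_boundaries_sub i) cm0 bm0 gen).
Qed.

End TorKoszul.

(** * Graphs of tuples and monomials of the letterplace ideal *)

Section Graphs.

Variables (n : nat) (d : Order.disp_t) (P : finPOrderType d).
Notation T := ('I_n * P)%type.
Implicit Types (t u : {ffun 'I_n -> P}) (R C : {set T}).

Definition graph t : {set T} := [set (j, t j) | j : 'I_n].

Lemma in_graph t x : (x \in graph t) = (x.2 == t x.1).
Proof.
apply/imsetP/eqP => [[j _ ->] //|]; case: x => j p /= ->.
by exists j.
Qed.

Lemma card_graph t : #|graph t| = n.
Proof. by rewrite card_imset ?card_ord // => i j []. Qed.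

Lemma graph_inj : injective graph.
Proof.
move=> t u tu; apply/ffunP => j; apply/eqP.
by rewrite -(in_graph u (j, t j)) -tu in_graph.
Qed.

Lemma graph_subP t R :
  reflect (forall j, t j \in slice R j) (graph t \subset R).
Proof.
apply: (iffP subsetP) => tR; first by move=> j; rewrite inE tR // in_graph.
by case=> j p; rewrite in_graph => /= /eqP ->; have := tR j; rewrite inE.
Qed.

Lemma setDD_sub R C : C \subset R -> R :\: (R :\: C) = C.
Proof. by move=> /setIidPr CR; rewrite setDDr setDv set0U. Qed.

Lemma setDgraph_inj R t u : graph t \subset R -> graph u \subset R ->
  R :\: graph t = R :\: graph u -> t = u.
Proof.
by move=> tR uR eqD; apply: graph_inj; rewrite -(setDD_sub tR) eqD setDD_sub.
Qed.

Definition update t j p := [ffun l => if l == j then p else t l].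

Lemma update_sub R t j p : graph t \subset R -> (j, p) \in R ->
  graph (update t j p) \subset R.
Proof.
move=> /graph_subP tR jpR; apply/graph_subP => l; rewrite ffunE.
by case: (eqVneq l j) => [->|_]; [rewrite inE | apply: tR].
Qed.

Lemma updateU t j p : p != t j ->
  graph (update t j p) = (j, p) |: graph t :\ (j, t j).
Proof.
move=> ne_p; apply/setP => -[l q]; rewrite !inE !in_graph /= ffunE !xpair_eqE.
by have [->|//] := eqVneq l j; rewrite /= andNb orbF.
Qed.

(** Any two tuples that choose elements from the columns of [R] are connected by
    changing one entry at a time. *)
Lemma graph_ind R (Q : {ffun 'I_n -> P} -> Prop) t u :
    (forall v j p, graph v \subset R -> (j, p) \in R ->
       Q v -> Q (update v j p)) ->
  graph t \subset R -> graph u \subset R -> Q t -> Q u.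
Proof.
move=> Qupd tR uR Qt.
(* [h s] has switched from [t] to [u] in the first [s] columns. *)
pose h s := [ffun l : 'I_n => if (l < s)%N then u l else t l].
suff hP s : (s <= n)%N -> graph (h s) \subset R /\ Q (h s).
  have [_] := hP n (leqnn n); congr Q.
  by apply/ffunP => l; rewrite ffunE ltn_ord.
elim: s => [_|s IHs lt_sn].
  by have -> : h 0%N = t by apply/ffunP => l; rewrite ffunE.
have [hR Qh] := IHs (ltnW lt_sn); pose j := Ordinal lt_sn.
have jR : (j, u j) \in R by rewrite (subsetP uR) // in_graph.
have -> : h s.+1 = update (h s) j (u j).
  apply/ffunP => l; rewrite !ffunE ltnS leq_eqVlt -(inj_eq val_inj) /=.
  by case: (eqVneq (l : nat) s) => [ls|] //=; congr (u _); apply: val_inj.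
by split; [apply: update_sub | apply: Qupd].
Qed.

End Graphs.

Section LetterplaceMonomials.

Local Open Scope ring_scope.

Variables (k : fieldType) (n : nat) (d : Order.disp_t) (P : finPOrderType d).
Notation T := ('I_n * P)%type.
Implicit Types (t u : {ffun 'I_n -> P}) (R C : {set T}).

Lemma prod_lp_var t :
  \prod_(i < n) lp_var k i (t i) = 'X_[mset (graph t)].
Proof.
rewrite mprodXE; congr 'X_[_]; apply/mnmP => v.
rewrite -(enum_valK v) mset_rank mnm_sumE in_graph.
set x := enum_val v; rewrite (bigD1 x.1) //= big1 => [|i ne_i].
  rewrite addn0 mnm1E (inj_eq enum_rank_inj).
  by case: (x) => i p /=; rewrite xpair_eqE eqxx eq_sym.
rewrite mnm1E (inj_eq enum_rank_inj); apply/eqP; rewrite eqb0.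
by apply: contra ne_i => /eqP <-.
Qed.

Lemma letterplace_graph t :
  multichain t -> letterplace k n P 'X_[mset (graph t)].
Proof.
move=> mt; exists (fun u => if u == t then 1 else 0).
rewrite (bigD1 t) //= eqxx mul1r prod_lp_var big1 ?addr0 //.
move=> u /andP[_ /negPf->].
by rewrite mul0r.
Qed.

Lemma letterplace_mset C : letterplace k n P 'X_[mset C] ->
  exists2 t, multichain t & graph t \subset C.
Proof.
case=> c /(congr1 (mcoeff (mset C))).
rewrite mcoeffX eqxx raddf_sum /= => /esym E.
have [t /andP[mt ct]] : exists t, multichain t &&
    ((c t * \prod_(i < n) lp_var k i (t i))@_(mset C) != 0).
  apply/existsP; apply: contraT; rewrite negb_exists => /forallP c0.
  move: E => /eqP; rewrite big1 => [|t mt]; first by rewrite eq_sym oner_eq0.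
  by have := c0 t; rewrite mt negbK => /eqP.
exists t => //; rewrite -mset_le; move: ct; rewrite prod_lp_var -mcoeff_msupp.
by rewrite (perm_mem (msuppMX _ _)) => /mapP[m _ ->]; apply: lem_addr.
Qed.

End LetterplaceMonomials.

(** * The top Koszul homology of the letterplace ideal *)

Section LetterplaceKoszul.

Local Open Scope ring_scope.

Variables (k : fieldType) (n : nat) (d : Order.disp_t) (P : finPOrderType d).
Notation T := ('I_n * P)%type.
Implicit Types (t u : {ffun 'I_n -> P}) (x y : T).
Variable R : {set T}.

(** Columns first: no variable of another column lies between two variables of
    the same column, which is what [sign_column] needs. *)
Definition lex_key x : nat := (x.1 * #|P| + enum_rank x.2)%N.

Lemma lex_key_lt x y : (x.1 < y.1)%N -> (lex_key x < lex_key y)%N.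
Proof.
move=> lt_xy; apply: (@leq_trans (x.1.+1 * #|P|)%N); last first.
  by apply: leq_trans (leq_addr _ _); rewrite leq_mul2r lt_xy orbT.
by rewrite mulSnr ltn_add2l ltn_ord.
Qed.

Lemma lex_key_inj : injective lex_key.
Proof.
move=> x y eq_xy.
case: (ltngtP x.1 y.1) => [/lex_key_lt|/lex_key_lt|/val_inj eq1].
- by rewrite eq_xy ltnn.
- by rewrite eq_xy ltnn.
move: eq_xy; rewrite /lex_key eq1 => /addnI/val_inj/enum_rank_inj.
by case: x y eq1 => [i p] [j q] /= -> ->.
Qed.

Notation sign := (ksign k lex_key).
Notation J := (letterplace k n P).
Notation kfam := {ffun {set T} -> 'rV[k]_1}.
Notation kbd := (kbd lex_key).
Notation top_chain := (ideal_chain J R (#|R| - n)).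
Notation top_cycle := (ideal_cycle lex_key J R (#|R| - n)).

Lemma card_setDgraph t : graph t \subset R -> #|R :\: graph t| = (#|R| - n)%N.
Proof. by move=> tR; rewrite cardsD (setIidPr tR) card_graph. Qed.

(** In homological degree [#|R| - n] only monomials of degree [n] are left in
    [J], and these are its generators. *)
Lemma top_chainP (m : kfam) A : (n <= #|R|)%N -> top_chain m -> m A 0 0 != 0 ->
  exists t, [/\ multichain t, graph t \subset R & A = R :\: graph t].
Proof.
move=> le_nR cm /cm[sAR cA /letterplace_mset[t mt tRA]].
have tRA' : graph t = R :\: A.
  apply/eqP; rewrite eqEcard tRA card_graph cardsD (setIidPr sAR) cA.
  by rewrite subKn /=.
exists t; split=> //; first by rewrite tRA' subsetDl.
by rewrite tRA' setDD_sub.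
Qed.

(** One step higher only monomials of degree [n - 1] would remain, none of
    which lies in [J]; so the top Koszul homology consists of all cycles. *)
Lemma top_boundary0 (m : kfam) : (0 < n <= #|R|)%N ->
  ideal_boundary lex_key J R (#|R| - n) m -> m = 0.
Proof.
case/andP=> n0 le_nR [m' cm' ->].
suff -> : m' = 0 by apply: kbd_deg0 => A _; rewrite ffunE.
apply/ffunP => A; apply/rowP => b; rewrite ord1 !ffunE mxE; apply/eqP.
apply/negPn/negP => /cm'[sAR cA /letterplace_mset[t _ /subset_leq_card]].
rewrite card_graph cardsD (setIidPr sAR) cA subnS subKn //.
by rewrite leqNgt ltn_predL n0.
Qed.

(** The only graphs inside [(j, p) |: graph t] are the two that drop one of the
    elements of column [j].  So for a family supported on graphs the Koszul
    boundary compares its values at tuples that differ in one entry. *)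
Lemma kbd_swap (m : kfam) t j p :
    (forall A, m A 0 0 != 0 ->
       exists2 u, graph u \subset R & A = R :\: graph u) ->
    graph t \subset R -> (j, p) \in R -> p != t j ->
  kbd m (R :\: ((j, p) |: graph t)) 0 0
    = sign (j, p) (R :\: ((j, p) |: graph t)) * m (R :\: graph t) 0 0
      + sign (j, t j) (R :\: ((j, p) |: graph t))
          * m (R :\: graph (update t j p)) 0 0.
Proof.
move=> supp tR jpR ne_p; set C := _ |: _; set t' := update t j p.
have sCR : C \subset R by rewrite subUset sub1set jpR.
have jpt : (j, p) \notin graph t by rewrite in_graph.
have jpC : (j, p) \in C by rewrite setU11.
have jtC : (j, t j) \in C by rewrite setU1r // in_graph.
have ne_jt : (j, t j) != (j, p) by rewrite xpair_eqE eqxx eq_sym.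
have addC x : x \in C -> x |: R :\: C = R :\: (C :\ x).
  move=> xC; apply/setP => y; rewrite !inE.
  by have [->|_] := eqVneq y x; rewrite // (subsetP sCR).
have Cjp : C :\ (j, p) = graph t by rewrite setU1K.
have Cjt : C :\ (j, t j) = graph t'.
  rewrite (updateU ne_p); apply/setP => x; rewrite !inE.
  by have [->|_] := eqVneq x (j, p); rewrite //= eq_sym ne_jt.
rewrite kbdE (bigD1 (j, p)) /=; last by rewrite inE jpC.
rewrite addC // Cjp; congr (_ + _).
rewrite (bigD1 (j, t j)) /=; last by rewrite inE jtC ne_jt.
rewrite addC // Cjt.
rewrite big1 ?addr0 // => x /andP[/andP[xD xjp] xjt].
apply/eqP; rewrite mulf_eq0; apply/orP; right; apply/negPn/negP.
case/supp=> u uR xDu.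
have xR : x \in R.
  by have := setU11 x (R :\: C); rewrite xDu inE => /andP[].
have xC : x \in C by move: xD; rewrite inE xR andbT negbK.
have uC : graph u = C :\ x.
  rewrite -(setDD_sub uR) -xDu addC // setDD_sub //.
  by apply: subset_trans sCR; apply: subD1set.
move: xC; rewrite in_setU1 (negPf xjp) /= in_graph => /eqP x2.
have: (x.1, u x.1) \in C :\ x by rewrite -uC in_graph.
rewrite !inE in_graph /= => /andP[ne_x /orP[/eqP[x1 _]|/eqP ux]].
  by case/eqP: xjt; rewrite [LHS]surjective_pairing x2 x1.
by case/eqP: ne_x; rewrite ux [RHS]surjective_pairing x2.
Qed.

(** By [kbd_swap] a cycle that vanishes at a tuple vanishes at all its
    neighbours, hence everywhere by [graph_ind]. *)
Lemma top_cycle_eq0 (m : kfam) t : (n <= #|R|)%N -> top_cycle m ->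
  graph t \subset R -> m (R :\: graph t) 0 0 = 0 -> m = 0.
Proof.
move=> le_nR [cm m0] tR mt0; apply/ffunP => A; apply/rowP => b.
rewrite ord1 [in RHS]ffunE mxE; apply/eqP/negPn/negP => mA.
have [u [_ uR Au]] := top_chainP le_nR cm mA; case/eqP: mA; rewrite Au.
move: tR uR mt0; apply: (graph_ind (Q := fun u => m (R :\: graph u) 0 0 = 0)).
move=> v j p vR jpR mv0; have [pv|ne_p] := eqVneq p (v j).
  suff -> : update v j p = v by [].
  by apply/ffunP => l; rewrite ffunE; case: eqVneq => [->|].
have supp A' : m A' 0 0 != 0 ->
    exists2 u, graph u \subset R & A' = R :\: graph u.
  by move=> /(top_chainP le_nR cm)[w [_ wR ->]]; exists w.
have := kbd_swap supp vR jpR ne_p; rewrite m0 mv0 mulr0 add0r ffunE mxE.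
by move/esym/eqP; rewrite mulf_eq0 signr_eq0 => /eqP.
Qed.

(** The cycle that spans the top homology when all tuples are multichains.  Up
    to a global sign it is the tensor product, over the columns, of the
    alternating sums of the elements of a column. *)
Definition top_class : kfam :=
  [ffun A => if [exists t, (graph t \subset R) && (A == R :\: graph t)]
             then const_mx (\prod_(x in R :\: A) sign x R) else 0].

Lemma top_classE t : graph t \subset R ->
  top_class (R :\: graph t) 0 0 = \prod_(x in graph t) sign x R.
Proof.
move=> tR; rewrite ffunE ifT; first by rewrite mxE setDD_sub.
by apply/existsP; exists t; rewrite tR eqxx.
Qed.

Lemma top_class_supp A : top_class A 0 0 != 0 ->
  exists2 t, graph t \subset R & A = R :\: graph t.
Proof.
rewrite ffunE; case: existsP => [[t /andP[tR /eqP->]] _|]; first by exists t.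
by rewrite mxE eqxx.
Qed.

Lemma sign_splitD x (C : {set T}) : C \subset R ->
  sign x (R :\: C) * sign x C = sign x R.
Proof.
move=> sCR; rewrite /ksign -exprD; congr (_ ^+ _).
rewrite addnC -(cardsID C [set y in R | _]).
congr (_ + _)%N; apply: eq_card => y.
  rewrite !inE; have [yC|_] := boolP (y \in C); last by rewrite andbF.
  by rewrite (subsetP sCR) // andbT.
by rewrite !inE andbA.
Qed.

(** In the order [lex_key] exactly one of the two elements of column [j] counts
    the other, and all other elements of the graph count the same for both. *)
Lemma sign_column t j p : p != t j ->
  sign (j, p) ((j, p) |: graph t) = - sign (j, t j) ((j, p) |: graph t).
Proof.
move=> ne_p; set E := graph t :\ (j, t j).
have jtE : (j, t j) \notin E by rewrite !inE eqxx.
have gE : graph t = (j, t j) |: E by rewrite setD1K // in_graph.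
have jpt : (j, p) \notin graph t by rewrite in_graph.
have ne_key : lex_key (j, p) != lex_key (j, t j).
  by rewrite (inj_eq lex_key_inj) xpair_eqE eqxx.
have signE : sign (j, p) E = sign (j, t j) E.
  congr (_ ^+ #|pred_of_set _|); apply/setP => x; rewrite !inE in_graph.
  have [/eqP x2|] //= := boolP (x.2 == t x.1); rewrite ?andbF // andbT.
  have [xj|ne_xj] /= := boolP (x != (j, t j)) => //.
  have : x.1 != j.
    by apply: contra xj => /eqP x1; rewrite [x]surjective_pairing x2 x1.
  case: (ltngtP x.1 j) => // [lt|lt|/val_inj ->]; last by rewrite eqxx.
    by rewrite !lex_key_lt.
  by move=> _; rewrite ltnNge [RHS]ltnNge !(ltnW (lex_key_lt _)).
rewrite !ksignU1 // gE !ksignU1 // signE ltnn mul1r !mulrA.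
by move: ne_key; case: ltngtP; rewrite ?ltnn ?mul1r ?mulr1 ?mulN1r ?opprK.
Qed.

(** At the set [C] formed by a tuple and one more element of a column, both
    terms of [kbd_swap] are the product of the signs in [R] of all elements of [C],
    times the sign in [C] of the element left out; these are opposite. *)
Lemma top_class_bd : kbd top_class = 0.
Proof.
apply/ffunP => D; apply/rowP => b; rewrite ord1 [in RHS]ffunE mxE.
have [x /andP[xD /top_class_supp[t tR xDt]]|no] :=
    pickP (fun x => (x \notin D) && (top_class (x |: D) 0 0 != 0)); last first.
  rewrite kbdE big1 // => x xD; have := no x; rewrite xD /= => /negbFE/eqP->.
  by rewrite mulr0.
have : x \in R :\: graph t by rewrite -xDt setU11.
have -> : D = R :\: (x |: graph t).
  by rewrite setUC -setDDl -xDt setU1K.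
case: x {xD xDt} => j p; rewrite inE in_graph /= => /andP[ne_p jpR].
rewrite (kbd_swap top_class_supp) // !top_classE ?update_sub //.
set C := _ |: _; have sCR : C \subset R by rewrite subUset sub1set jpR.
have signD x : sign x (R :\: C) = sign x R * sign x C.
  by rewrite -(sign_splitD x sCR) -mulrA ksign_sq mulr1.
have prodC x (E : {set T}) : x \notin E -> C = x |: E ->
    sign x (R :\: C) * \prod_(y in E) sign y R
      = sign x C * \prod_(y in C) sign y R.
  by move=> xE CE; rewrite signD mulrAC mulrC CE big_setU1 // mulrA.
have jpt : (j, p) \notin graph t by rewrite in_graph.
rewrite (prodC (j, p) (graph t)) //.
rewrite (prodC (j, t j) (graph (update t j p))) ?(sign_column ne_p).
- by rewrite mulNr addNr.
- by rewrite in_graph /= ffunE eqxx eq_sym.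
by rewrite updateU // setUCA setD1K // in_graph.
Qed.

Lemma ideal_cycle_lin q c m m' :
  ideal_cycle lex_key J R q m -> ideal_cycle lex_key J R q m' ->
  ideal_cycle lex_key J R q (c *: m + m').
Proof.
case=> cm m0 [cm' m'0]; split; last by rewrite kbd_lin m0 m'0 scaler0 addr0.
move=> A; rewrite !ffunE !mxE.
have [mA|mA _] := eqVneq (m A 0 0) 0; last exact: cm.
by rewrite mA mulr0 add0r; apply: cm'.
Qed.

Lemma ideal_boundary0 q : ideal_boundary lex_key J R q 0.
Proof.
exists 0; first by move=> A; rewrite ffunE mxE eqxx.
by apply/esym/kbd_deg0 => A _; rewrite ffunE.
Qed.

Hypothesis n_gt0 : (0 < n)%N.

(** A cycle vanishes at a tuple that is not a multichain, where [J] has no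
    monomial, and so it vanishes everywhere. *)
Lemma betti_top_eq0 (F : mgfree_resolution J) t :
  graph t \subset R -> ~~ multichain t -> betti F (#|R| - n) (mset R) = 0%N.
Proof.
move=> tR not_mt; apply: (betti_eq0 lex_key_inj) => m cm.
have le_nR : (n <= #|R|)%N by have := subset_leq_card tR; rewrite card_graph.
suff -> : m = 0 by apply: ideal_boundary0.
apply: (top_cycle_eq0 le_nR cm tR); apply/eqP/negPn/negP.
case/(top_chainP le_nR (proj1 cm)) => u [mu uR tu].
by rewrite (setDgraph_inj tR uR tu) mu in not_mt.
Qed.

(** Two cycles that agree at one tuple are equal, so every cycle is a multiple
    of [top_class]. *)
Lemma betti_top_eq1 (F : mgfree_resolution J) t : graph t \subset R ->
    (forall u, graph u \subset R -> multichain u) ->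
  betti F (#|R| - n) (mset R) = 1%N.
Proof.
move=> tR allm.
have le_nR : (n <= #|R|)%N by have := subset_leq_card tR; rewrite card_graph.
have ct0 : top_class (R :\: graph t) 0 0 != 0.
  by rewrite top_classE //; apply/prodf_neq0 => x _; rewrite signr_eq0.
have cyc : top_cycle top_class.
  split; last exact: top_class_bd.
  move=> A /top_class_supp[u uR ->].
  rewrite subsetDl card_setDgraph // setDD_sub //.
  by split=> //; apply/letterplace_graph/allm.
apply: (betti_eq1 lex_key_inj F cyc) => [/top_boundary0|m cm].
  by move=> /(_ _) c0; move: ct0; rewrite c0 ?n_gt0 // ffunE mxE eqxx.
(* The multiple for which the sum vanishes at [t]. *)
exists (- (m (R :\: graph t) 0 0 / top_class (R :\: graph t) 0 0)).
set c := - _; suff -> : c *: top_class + m = 0 by apply: ideal_boundary0.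
apply: (top_cycle_eq0 le_nR _ tR); first exact: ideal_cycle_lin.
move: top_class ct0 @c => w w0 c.
by rewrite !ffunE !mxE /c mulNr divfK // addNr.
Qed.

End LetterplaceKoszul.

(** * The first linear strand *)

Lemma multichain_succ (n : nat) (d : Order.disp_t) (P : finPOrderType d)
    (t : {ffun 'I_n -> P}) :
  (forall j j' : 'I_n, nat_of_ord j' = j.+1 -> (t j <= t j')%O) -> multichain t.
Proof.
move=> step; apply/forallP => i; apply/forallP => -[j lt_j]; apply/implyP => /=.
elim: j lt_j => [|j IHj] lt_j; rewrite leq_eqVlt => /orP[/eqP eq_i|lt_i] //.
- by have -> : i = Ordinal lt_j by apply: val_inj.
- by have -> : i = Ordinal lt_j by apply: val_inj.
exact: Order.POrderTheory.le_trans (IHj (ltnW lt_j) lt_i) (step _ _ _).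
Qed.

Theorem proposition3p12 (k : fieldType) (d : Order.disp_t)
    (P : finPOrderType d) (n : nat) (n_gt0 : (0 < n)%N)
    (R : {set 'I_n * P}) (R_neq0 : forall j : 'I_n, slice R j != set0)
    (F : mgfree_resolution (letterplace k n P)) :
  (betti F (#|R| - n) (mdeg_set R) <> 0%N <->
     (forall j j' : 'I_n, nat_of_ord j' = j.+1 ->
        forall p q : P, p \in slice R j -> q \in slice R j' -> (p <= q)%O)) /\
  ((forall j j' : 'I_n, nat_of_ord j' = j.+1 ->
      forall p q : P, p \in slice R j -> q \in slice R j' -> (p <= q)%O) ->
   betti F (#|R| - n) (mdeg_set R) = 1%N).
Proof.
have [r rR] : exists r : {ffun 'I_n -> P}, graph r \subset R.
  have /fin_all_exists[r rP] : forall j, exists p, p \in slice R j.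
    by move=> j; apply/set0Pn.
  by exists [ffun j => r j]; apply/graph_subP => j; rewrite ffunE.
set cond := (X in _ <-> X).
have one : cond -> betti F (#|R| - n) (mdeg_set R) = 1%N.
  move=> condR; apply: (betti_top_eq1 n_gt0 F rR) => u /graph_subP uR.
  by apply: multichain_succ => j j' jj'; apply: condR jj' _ _ _ _.
split=> //; split=> [nz j j' jj' p q pj qj'|/one-> //].
apply/negPn/negP => not_pq; apply: nz.
pose t := update (update r j p) j' q.
have tR : graph t \subset R.
  by rewrite !update_sub //; [move: pj | move: qj']; rewrite inE.
apply: (betti_top_eq0 F tR).
apply: contra not_pq => /forallP/(_ j)/forallP/(_ j')/implyP.
rewrite jj' leqnSn !ffunE eqxx ifN ?eqxx; first exact.
by apply/eqP => jj; move: jj'; rewrite jj => /eqP; rewrite ltn_eqF.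
Qed.
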